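(* Let $G$ be a regular $T_1$ collectionwise Hausdorff paratopological group of countable pseudocharacter with a suitable set $S$ and let $H$ be a sequentially dense subgroup of $G$. Then $H$ has a suitable set of size at most $|S|\cdot\aleph_0$.
   Context: A paratopological group is a group $G$ endowed with a topology such that the group operation $G\times G\to G$ is continuous (inversion need not be continuous). The identity is denoted by $e$. A subset $S$ of a paratopological group $G$ is a suitable set for $G$ if $S$ is a discrete subspace of $G$, $S\cup\{e\}$ is closed in $G$, and the subgroup $\langle S\rangle$ generated by $S$ is dense in $G$. Subgroups carry the subspace topology. A subset $D$ of a space $X$ is strongly discrete if each point $x\in D$ has a neighborhood $U_x$ such that the family $\{U_x:x\in D\}$ is discrete, that is, each point of $X$ has a neighborhood intersecting at most one set of the family. A space is collectionwise Hausdorff if each of its closed discrete subsets is strongly discrete. A subset $D$ of a space $X$ is sequentially dense (in $X$) if each point $x\in X$ is a limit of a sequence of points of $D$. The pseudocharacter $\psi(X)$ of a space $X$ is the smallest infinite cardinal $\kappa$ such that for any point $x\in X$ the set $\{x\}$ is an intersection of at most $\kappa$ open subsets of $X$; countable pseudocharacter means $\psi(X)\le\omega$. *)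

(* Defs.v *)
From HB Require Import structures.
From mathcomp Require Import all_boot all_classical.
From mathcomp Require Import reals topology.

Set Implicit Arguments.
Unset Strict Implicit.
Unset Printing Implicit Defensive.

Local Open Scope classical_set_scope.

HB.structure Definition PreTopologicalGroup :=
  {G of Topological G & Group G}.

HB.mixin Record PreTopologicalGroup_isParatopological G
    & PreTopologicalGroup G := {
  mulg_continuous : continuous (fun x : G * G => (x.1 * x.2)%g)
}.

#[short(type="paratopologicalGroupType")]
HB.structure Definition ParatopologicalGroup :=
  {G of PreTopologicalGroup G & PreTopologicalGroup_isParatopological G}.

Definition is_subgroup (G : groupType) (H : set G) : Prop :=
  group_closed [in H].

Definition subgroup_gen (G : groupType) (S : set G) : set G :=
  smallest (@is_subgroup G) S.

(* A subgroup H as a group in its own right: the closure proof is a parameter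
   so that the operations can be restricted to the subtype [set_type H], whose
   topology is the subspace topology. *)
Definition subgroup_type (G : groupType) (H : set G) (_ : is_subgroup H)
  : Type := set_type H.

Section subgroup_type.
Context (G : paratopologicalGroupType) (H : set G) (grH : is_subgroup H).

HB.instance Definition _ :=
  SubChoice.copy (subgroup_type grH) (set_type H).
HB.instance Definition _ :=
  SubChoice_isSubGroup.Build G _ (subgroup_type grH) grH.
HB.instance Definition _ :=
  Topological.copy (subgroup_type grH) (set_type H).


Lemma subgroup_mulg_continuous :
  continuous (fun x : subgroup_type grH * subgroup_type grH => (x.1 * x.2)%g).
Proof.
apply: continuous_comp_initial => x.
have val_cts : continuous (\val : subgroup_type grH -> G).
  exact: initial_continuous.
have pair_cts : {for x,
    continuous (fun z : subgroup_type grH * subgroup_type grH =>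
      (val z.1, val z.2) : G * G)}.
  apply: cvg_pair => /=.
  - by apply: cvg_comp; [exact: cvg_fst|exact: val_cts].
  - by apply: cvg_comp; [exact: cvg_snd|exact: val_cts].
exact: (continuous_comp pair_cts (mulg_continuous _)).
Qed.

HB.instance Definition _ :=
  PreTopologicalGroup_isParatopological.Build (subgroup_type grH)
    subgroup_mulg_continuous.

End subgroup_type.

Section topology_notions.
Context (T : topologicalType).
Implicit Types D : set T.

(* [set_type D] carries the subspace topology. *)
Definition discrete_subspace D : Prop := forall A : set (set_type D), open A.

(* The family is indexed by the points of D: distinct indices count as distinct
   members even if the corresponding sets are equal. *)
Definition discrete_family (I : Type) (D : set I) (U : I -> set T) : Prop :=
  forall y : T, exists2 V : set T, nbhs y V &
    forall i j, D i -> D j -> V `&` U i !=set0 -> V `&` U j !=set0 -> i = j.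

Definition strongly_discrete D : Prop :=
  exists2 U : T -> set T, (forall x, D x -> nbhs x (U x)) & discrete_family D U.

Definition collectionwise_hausdorff : Prop :=
  forall D, closed D -> discrete_subspace D -> strongly_discrete D.

Definition sequentially_dense D : Prop :=
  forall x : T, exists2 u : nat -> T, (forall n, D (u n)) & u @ \oo --> x.

Definition countable_pseudocharacter : Prop :=
  forall x : T, exists F : set_system T,
    [/\ countable F, F `<=` open & \bigcap_(U in F) U = [set x]].

End topology_notions.

Arguments collectionwise_hausdorff : clear implicits.
Arguments countable_pseudocharacter : clear implicits.

Definition suitable_set (G : paratopologicalGroupType) (S : set G) : Prop :=
  [/\ discrete_subspace S, closed (S `|` [set 1%g]) & dense (subgroup_gen S)].

(* Main.v *)
(** The points [x != 1] of [S] have neighbourhoods [O x] that form a locally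
    finite family at every point other than [1]. If every [x] is replaced by a
    sequence of [H] lying in [O x] and converging to [x] (constantly [x] when
    [x] is already in [H]), the resulting set has no accumulation point in [H]
    except possibly [1].

    The closure of a subgroup of a paratopological group is only a submonoid, so
    it must be made to contain [x^-1] too. Given sequences [u --> x] and
    [v --> x^-1] in [H], the sequence attached to [x] interleaves [u] with
    [v * u * u]: both converge to [x], and together they generate [v]. *)

Require Import Defs.
From mathcomp Require Import all_boot all_classical.
From mathcomp Require Import reals topology.

Local Open Scope classical_set_scope.
Local Open Scope card_scope.

(** * Limit points, discreteness and discrete families *)

Section topology.
Context {T : topologicalType}.
Implicit Types (A D : set T) (x y : T).

Lemma not_limit_pointP A y :
  ~ limit_point A y <-> \forall z \near y, A z -> z = y.
Proof.
split=> [/existsNP[U /not_implyP[Uy noU]]|yA /(_ _ yA)[z [/eqP zy Az]]].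
  apply: filterS Uy => z Uz Az; apply: contrapT => /eqP zy.
  by apply: noU; exists z.
by move/(_ Az).
Qed.

Lemma nbhs_set_val D (a : set_type D) (U : set T) :
  nbhs (\val a) U -> nbhs a (\val @^-1` U).
Proof. exact: initial_continuous. Qed.

Lemma discrete_subspaceP D :
  discrete_subspace D <-> forall x, D x -> ~ limit_point D x.
Proof.
split=> [dD x Dx|dD A].
  have [U oU UE] := dD [set SigSub (mem_set Dx)].
  apply/not_limit_pointP.
  have Ux : U x.
    by have : (set_val @^-1` U) (SigSub (mem_set Dx)) by rewrite UE.
  apply: filterS (open_nbhs_nbhs (conj oU Ux)) => z Uz Dz.
  have : (set_val @^-1` U) (SigSub (mem_set Dz)) by [].
  by rewrite UE => -[].
rewrite openE => a Aa.
have /not_limit_pointP aD := dD _ (set_mem (valP a)).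
apply: filterS (nbhs_set_val _ _ _ aD) => b.
by move=> /(_ (set_mem (valP b))) /(@val_inj _ _ (set_type D)) ->.
Qed.

Lemma limit_point_sub A D : A `<=` D -> limit_point A `<=` limit_point D.
Proof. by move=> AD y yA U /yA[z [zy /AD Dz Uz]]; exists z. Qed.

Lemma limit_point_finite A : accessible_space T -> finite_set A ->
  limit_point A = set0.
Proof.
move=> T1 finA; rewrite -subset0 => y; apply/not_limit_pointP.
have clA : closed (A `\ y).
  by move/accessible_finite_set_closed: T1; apply; exact: finite_setD.
have : nbhs y (~` (A `\ y)).
  by apply: open_nbhs_nbhs; split=> [|[_]]; [exact: closed_openC|exact].
by apply: filterS => z nz Az; apply: contrapT => zy; apply: nz.
Qed.

(** By regularity a point [y] other than [x] has a neighbourhood whose closure misses [x]. Only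
    finitely many terms lie in it, and finite sets have no limit points in a T1 space. *)
Lemma cvg_limit_point (t : nat -> T) x :
  regular_space T -> accessible_space T -> t @ \oo --> x ->
  limit_point (range t) `<=` [set x].
Proof.
move=> T3 T1 tx y; apply: contraPP => yx.
have : nbhs y (~` [set x]).
  apply: open_nbhs_nbhs; split=> //.
  exact/closed_openC/accessible_closed_set1.
move=> /T3[B yB clB]; apply/not_limit_pointP.
have [N _ NB] : nbhs \oo (t @^-1` ~` B).
  apply: tx; have : nbhs x (~` closure B).
    apply: open_nbhs_nbhs; split=> [|/clB]; last exact.
    exact/closed_openC/closed_closure.
  by apply: filterS => z; apply: contra_not; exact: subset_closure.
have : ~ limit_point (t @` `I_N) y.
  by rewrite limit_point_finite//; exact/finite_image/finite_II.
move=> /not_limit_pointP yN; near=> z => -[n _ tn].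
have nN : (n < N)%N.
  rewrite ltnNge; apply/negP => /NB /=; rewrite tn; apply.
  by near: z.
by apply: (near yN z) => //; exists n.
Unshelve. all: by end_near. Qed.

(** Some neighbourhood of [y] meets at most one [U i], so inside it the union reduces to a single
    [A i] or is empty. *)
Lemma discrete_family_limit_point (I : Type) (D : set I) (U A : I -> set T) y :
  discrete_family D U -> (forall i, D i -> A i `<=` U i) ->
  limit_point (\bigcup_(i in D) A i) y -> exists2 i, D i & limit_point (A i) y.
Proof.
move=> dU AU; apply: contraPP => /forall2NP yA; apply/not_limit_pointP.
have [V yV VU] := dU y.
have [[i Di [w [Vw Uw]]]|noU] := pselect (exists2 i, D i & V `&` U i !=set0).
  have [//|/not_limit_pointP yAi] := yA i.
  near=> z => -[j Dj Ajz].
  have ij : i = j.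
    apply: VU => //; first by exists w.
    by exists z; split; [near: z|exact: AU].
  by apply: (near yAi z) => //; rewrite ij.
apply: filterS yV => z Vz [j Dj Ajz]; exfalso; apply: noU.
by exists j => //; exists z; split=> //; exact: AU.
Unshelve. all: by end_near. Qed.

Lemma interleave_cvg (u v : nat -> T) x : u @ \oo --> x -> v @ \oo --> x ->
  (fun n => if odd n then v n./2 else u n./2) @ \oo --> x.
Proof.
move=> ux vx A xA.
have [[N _ NA] [M _ MA]] := (ux _ xA, vx _ xA).
exists (maxn N M).*2 => // n /= /half_leq; rewrite doubleK geq_max => /andP[Nn Mn].
by case: odd; [exact: MA|exact: NA].
Qed.

(** With [x] the identity, this yields the first two clauses of [suitable_set]. *)
Lemma closed_discrete_limit_point A x : accessible_space T ->
  ~ A x -> limit_point A `<=` [set x] ->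
  discrete_subspace A /\ closed (A `|` [set x]).
Proof.
move=> T1 nAx Ax; split.
  by apply/discrete_subspaceP => y Ay /Ax yx; apply: nAx; rewrite -yx.
move=> y yA; apply: contrapT => /not_orP[nAy yx].
have /not_limit_pointP yA' : ~ limit_point A y by move/Ax.
have yx' : nbhs y (~` [set x]).
  by apply: open_nbhs_nbhs; split=> //; exact/closed_openC/accessible_closed_set1.
have [z [[Az|zx] [zy nzx]]] := yA _ (filterI yA' yx'); last exact: nzx.
by apply: nAy; rewrite -(zy Az).
Qed.

End topology.

(** * Closures of subgroups, and neighbourhoods of the points of [S] *)

Section subgroups.
Context {G : paratopologicalGroupType}.
Implicit Types K H S : set G.

Lemma is_subgroupP K : is_subgroup K <->
  [/\ K 1%g, forall x y, K x -> K y -> K (x * y)%g & forall x, K x -> K x^-1%g].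
Proof.
split=> [[K1 KD]|[K1 KM KV]].
  have KV x : K x -> K x^-1%g.
    move=> Kx; have := KD 1%g x K1; rewrite div1g => /(_ (mem_set Kx)).
    exact: set_mem.
  split=> [|x y Kx Ky|//]; first exact: set_mem.
  have := KD x y^-1%g (mem_set Kx) (mem_set (KV _ Ky)).
  by rewrite invgK => /set_mem.
split=> [|x y /set_mem Kx /set_mem Ky]; first exact: mem_set.
by apply: mem_set; apply: KM => //; exact: KV.
Qed.

Lemma is_subgroup_gen S : is_subgroup (subgroup_gen S).
Proof.
apply/is_subgroupP; split=> [K [/is_subgroupP[]]//|x y Sx Sy K SK|x Sx K SK].
  by have [/is_subgroupP[_ KM _] _] := SK; apply: KM; [exact: Sx|exact: Sy].
by have [/is_subgroupP[_ _ KV] _] := SK; apply: KV; exact: Sx.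
Qed.

Lemma closureM {K} : (forall x y, K x -> K y -> K (x * y)%g) ->
  forall x y, closure K x -> closure K y -> closure K (x * y)%g.
Proof.
move=> KM x y Kx Ky A /(mulg_continuous (x, y))[[B C] /= [xB yC] BCA].
have [[b [Kb Bb]] [c [Kc Cc]]] := (Kx _ xB, Ky _ yC).
by exists (b * c)%g; split; [exact: KM|exact: (BCA (b, c))].
Qed.

(** Inversion may be discontinuous, so [closure K] need not be stable under it. The points that lie
    in [closure K] together with their inverses do form a subgroup. *)
Lemma sub_closure_subgroup_gen S K : is_subgroup K ->
  (forall x, S x -> closure K x /\ closure K x^-1%g) ->
  subgroup_gen S `<=` closure K.
Proof.
move=> /is_subgroupP[K1 KM _] SK.
suff : subgroup_gen S `<=` [set x | closure K x /\ closure K x^-1%g].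
  by move=> sub x /sub[].
apply: smallest_sub => //; apply/is_subgroupP; split=> /=.
- by rewrite invg1; split; exact: subset_closure.
- move=> x y [Kx Kx'] [Ky Ky']; rewrite invgM.
  by split; exact: closureM.
- by move=> x [Kx Kx']; rewrite invgK.
Qed.

Lemma cvg_closure (t : nat -> G) K x :
  t @ \oo --> x -> (\forall n \near \oo, K (t n)) -> closure K x.
Proof.
move=> tx Kt A /tx At.
by have [n [Kn An]] := filter_ex (filterI Kt At); exists (t n).
Qed.

Lemma cvgM (u v : nat -> G) x y :
  u @ \oo --> x -> v @ \oo --> y -> (fun n => u n * v n)%g @ \oo --> (x * y)%g.
Proof. by move=> ux vy; apply: cvg_comp2 ux vy (mulg_continuous (x, y)). Qed.

(** [K] is only asked to contain almost all terms, because the terms outside the neighbourhood of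
    [x] will be discarded. *)
Lemma sequence_to_point_and_inverse {H} x :
  is_subgroup H -> sequentially_dense H -> exists t : nat -> G,
  [/\ forall n, H (t n), t @ \oo --> x, H x -> forall n, t n = x &
      forall K, is_subgroup K -> (\forall n \near \oo, K (t n)) ->
      closure K x /\ closure K x^-1%g].
Proof.
move=> /is_subgroupP[H1 HM HV] Hd.
have [Hx|nHx] := pselect (H x).
  exists (fun=> x); split=> //; first exact: cvg_cst.
  move=> K /is_subgroupP[_ _ KV] /filter_ex[_ Kx].
  by split; apply: subset_closure => //; exact: KV.
have [[u Hu ux] [v Hv vx]] := (Hd x, Hd x^-1%g).
pose w n := (v n * (u n * u n))%g.
have wx : w @ \oo --> x.
  (* The limit is written as [x^-1 * (x * x)], matching the shape of [w]. *)
  rewrite -[X in _ --> X]mul1g -(mulVg x) -mulgA.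
  by apply: cvgM => //; exact: cvgM.
pose t n := if odd n then w n./2 else u n./2.
have tx : t @ \oo --> x by exact: interleave_cvg.
exists t; split=> // [n|K /is_subgroupP[_ KM KV] Kt].
  by rewrite /t; case: odd => //; exact: (HM _ _ (Hv _) (HM _ _ (Hu _) (Hu _))).
split; first exact: cvg_closure tx Kt.
(* The terms of index [2n] and [2n+1] are [u n] and [w n]; both lie in [K] for large [n], and they
   determine [v n]. *)
apply: (cvg_closure _ _ _ vx); case: Kt => N _ NK; exists N => // n /= Nn.
have Ku : K (u n).
  have := NK n.*2; rewrite /t /= odd_double doubleK; apply.
  by rewrite (leq_trans Nn)// -addnn leq_addr.
have Kw : K (w n).
  have := NK n.*2.+1; rewrite /t /= odd_double /= uphalf_double; apply.
  by rewrite (leq_trans Nn)// leqW// -addnn leq_addr.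
have -> : v n = (w n * (u n * u n)^-1)%g by rewrite /w mulgK.
exact: (KM _ _ Kw (KV _ (KM _ _ Ku Ku))).
Qed.

(** Regularity shrinks each member of a countable family with intersection [[set 1%g]] to an open
    neighbourhood of 1 whose closure stays inside that member. *)
Lemma pseudocharacter_closures :
  regular_space G -> countable_pseudocharacter G ->
  exists B : nat -> set G, [/\ forall n, open (B n), forall n, B n 1%g &
    forall x, x != 1%g -> exists n, ~ closure (B n) x].
Proof.
move=> T3 /(_ 1%g)[F [/countable_injP[f finj] Fo F1]].
have step n : exists B : set G, [/\ open B, B 1%g &
    forall U, F U -> f U = n -> closure B `<=` U].
  have [[U FU fU]|noU] := pselect (exists2 U, F U & f U = n); last first.
    (* An index that numbers no member of [F] imposes no constraint and gets the whole space. *)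
    by exists setT; split=> // [|U FU fU]; [exact: openT|case: noU; exists U].
  have : nbhs (1%g : G) U.
    apply: open_nbhs_nbhs; split; first exact: Fo.
    by have : [set 1%g : G] 1%g by []; rewrite -F1; exact.
  move=> /T3[C]; rewrite nbhsE => -[B [oB B1] BC] CU.
  exists B; split=> // V FV fV.
  have -> : V = U by apply: finj; rewrite ?inE// fV.
  by apply: subset_trans CU; exact: closureS.
have [B BP] := choice step; exists B; split=> [n|n|x].
- by case: (BP n).
- by case: (BP n).
move/eqP; apply: contra_notP => /forallNP clB.
suff : [set 1%g] x by [].
rewrite -F1 => U FU; have [_ _ /(_ U FU erefl)] := BP (f U); apply.
exact: contrapT (clB _).
Qed.

(** The part of [S] outside each [B n] is closed and discrete, so it has a discrete family of
    neighbourhoods [W n]. Each [x] takes its neighbourhood from the first stage at which it leaves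
    the sets [B n]. *)
Lemma locally_finite_neighborhoods {S} :
  regular_space G -> collectionwise_hausdorff G ->
  countable_pseudocharacter G ->
  discrete_subspace S -> closed (S `|` [set 1%g]) ->
  exists O : G -> set G,
    (forall x, S x -> x != 1%g -> nbhs x (O x)) /\
    forall (A : G -> set G) y, y != 1%g ->
      (forall x, A x `<=` O x) ->
      limit_point (\bigcup_(x in S `\ 1%g) A x) y ->
      exists2 x, S x & limit_point (A x) y.
Proof.
move=> T3 cwh pc dS cS.
have [B [oB B1 BF]] := pseudocharacter_closures T3 pc.
have sd n : exists U : G -> set G,
    (forall x, (S `\` B n) x -> nbhs x (U x)) /\ discrete_family (S `\` B n) U.
  suff [U] : strongly_discrete (S `\` B n) by exists U.
  apply: cwh.
    (* Since 1 lies in [B n], adding it to [S] does not change the difference. *)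
    have -> : S `\` B n = (S `|` [set 1%g]) `&` ~` B n.
      apply/seteqP; split=> [x [Sx Bx]|x [[Sx|->] Bx]] //; first by split=> //; left.
      by case: Bx.
    by apply: closedI => //; exact: open_closedC.
  apply/discrete_subspaceP => x [Sx _].
  move/(limit_point_sub _ _ (@subDsetl _ S (B n))).
  exact: (discrete_subspaceP S).1.
have [W WP] := choice sd.
pose first x n := ~ B n x /\ forall i, (i < n)%N -> B i x.
have firstP x : x != 1%g -> exists n, first x n.
  move=> /BF[m /(contra_not (@subset_closure _ _ _)) Bm].
  have exB : exists m, `[< ~ B m x >] by exists m; exact/asboolP.
  case: (ex_minnP exB) => n /asboolP Bn minn; exists n; split=> // i ltin.
  apply: contrapT => Bi; have /minn : `[< ~ B i x >] by exact/asboolP.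
  by rewrite leqNgt ltin.
(* Cutting [W n x] down to the earlier [B i] forces [n <= m] as soon as [O x] contains a point
   outside [B m]. *)
pose O x z := exists2 n, first x n & W n x z /\ forall i, (i < n)%N -> B i z.
exists O; split=> [x Sx /firstP[n fn]|A y y1 AO yA].
  have [/(_ x)/(_ (conj Sx fn.1)) xW _] := WP n.
  have xB : \forall z \near x, forall i : 'I_n, B i z.
    apply: filter_forall => i; apply: open_nbhs_nbhs; split=> //.
    exact: fn.2.
  near=> z; exists n => //; split; first by near: z.
  move=> i ltin; have zB : forall i : 'I_n, B i z by near: z.
  exact: (zB (Ordinal ltin)).
(* Off [closure (B m)] only the points leaving the [B i] at a stage [n <= m]
   matter, and each such stage contributes a discrete family. *)
have [m ym] := BF _ y1.
pose A_ n x z := A x z /\ W n x z.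
apply: contrapT => /forall2NP noA.
suff : ~ limit_point (\bigcup_(x in S `\ 1%g) A x) y by [].
have A_y (n : 'I_m.+1) : \forall z \near y,
    (\bigcup_(x in S `\` B n) A_ n x) z -> z = y.
  apply/not_limit_pointP => /(discrete_family_limit_point _ _ _ _ _ (WP n).2).
  case=> [x _ z []//|x [Sx _]].
  have A_A : A_ n x `<=` A x by move=> z [].
  by move/(limit_point_sub _ _ A_A); case: (noA x).
have yB : \forall z \near y, ~ B m z.
  have : nbhs y (~` closure (B m)).
    apply: open_nbhs_nbhs; split=> //.
    exact/closed_openC/closed_closure.
  by apply: filterS => z; apply: contra_not; exact: subset_closure.
apply/not_limit_pointP; near=> z => -[x [Sx x1] Axz].
have [n [nBx _] [Wz Bz]] := AO _ _ Axz.
have ltnm : (n < m.+1)%N.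
  by rewrite ltnS leqNgt; apply/negP => /Bz; near: z.
have zy : forall n : 'I_m.+1, (\bigcup_(x in S `\` B n) A_ n x) z -> z = y.
  near: z; exact: filter_forall.
by apply: (zy (Ordinal ltnm)); exists x.
Unshelve. all: by end_near. Qed.

End subgroups.

(** * Transfer between [G] and the subgroup [H] *)

Section subgroup_type.
Context {G : paratopologicalGroupType} {H : set G} {grH : is_subgroup H}.
Implicit Types (T : set (subgroup_type grH)) (y : subgroup_type grH).

Lemma subgroup_val_limit_point T y :
  limit_point T y -> limit_point (\val @` T) (\val y).
Proof.
apply: contraPP => /not_limit_pointP yT; apply/not_limit_pointP.
apply: filterS (nbhs_set_val _ _ _ yT) => z zy Tz; apply/val_inj/zy.
by exists z.
Qed.

Lemma subgroup_accessible :
  accessible_space G -> accessible_space (subgroup_type grH).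
Proof.
move=> T1 a b ab; have [U [oU aU bU]] := T1 (\val a) (\val b) ab.
exists (\val @^-1` U); split; first by exists U.
  by rewrite inE; exact: set_mem.
by rewrite inE; exact: set_mem bU.
Qed.

Lemma is_subgroup_val_image T :
  is_subgroup T -> is_subgroup (\val @` T : set G).
Proof.
move=> /is_subgroupP[T1 TM TV]; apply/is_subgroupP; split.
- by exists 1%g.
- move=> _ _ [a Ta <-] [b Tb <-]; exists (a * b)%g => //; exact: TM.
- by move=> _ [a Ta <-]; exists a^-1%g => //; exact: TV.
Qed.

Lemma subgroup_val_dense T :
  (forall x : G, closure (\val @` T) x) -> dense T.
Proof.
move=> clT O [a Oa] [U oU UO].
have Ua : U (\val a) by move: Oa; rewrite -UO.
have [_ [[b Tb <-] Ub]] := clT _ _ (open_nbhs_nbhs (conj oU Ua)).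
by exists b; split=> //; rewrite -UO.
Qed.

End subgroup_type.

Theorem proposition5p6 (G : paratopologicalGroupType) (S H : set G)
    (grH : is_subgroup H) :
  regular_space G -> accessible_space G -> collectionwise_hausdorff G ->
  countable_pseudocharacter G ->
  suitable_set S -> sequentially_dense H ->
  exists T : set (subgroup_type grH),
    suitable_set T /\ T #<= S `*` [set: nat].
Proof.
move=> T3 T1 cwh pc [dS cS genS] Hd.
have [O [xO Olf]] := locally_finite_neighborhoods T3 cwh pc dS cS.
have [t tP] := choice (fun x => sequence_to_point_and_inverse x grH Hd).
have tH x n : t x n \in H by apply: mem_set; case: (tP x).
pose A x := O x `&` range (t x) `\ 1%g.
pose s p : subgroup_type grH := SigSub (tH p.1 p.2).
(* Terms equal to 1 are left out so that 1, the only possible limit point of [T], is not in [T].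
   Indexing by pairs gives the cardinality bound. *)
pose T := s @` [set p | [/\ S p.1, p.1 != 1%g & A p.1 (t p.1 p.2)]].
have T_acc : limit_point T `<=` [set 1%g].
  move=> y /subgroup_val_limit_point yT; apply: contrapT => /eqP y1.
  have sub : \val @` T `<=` \bigcup_(x in S `\ 1%g) A x.
    by move=> _ [_ [[x n] /= [Sx /eqP x1 Ax] <-] <-]; exists x.
  have [||x Sx xA] := Olf A (\val y) _ _ (limit_point_sub _ _ sub _ yT).
  - by apply: contra y1 => /eqP y1; apply/eqP/val_inj.
  - by move=> x z [[]].
  have [_ tx tHx _] := tP x.
  have At : A x `<=` range (t x) by move=> z [[]].
  have yt := limit_point_sub _ _ At _ xA.
  (* The limit point must be [x] itself, so [x] is in [H]; then [t x] is constant and its range,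
     being finite, has no limit point. *)
  have yx := cvg_limit_point _ _ T3 T1 tx _ yt.
  have Hx : H x by rewrite -yx; exact: set_mem (valP y).
  have fint : finite_set (range (t x)).
    by apply: sub_finite_set (finite_set1 x) => _ [n _ <-]; exact: tHx.
  by move: yt; rewrite limit_point_finite.
exists T; split; last first.
  apply: (card_le_trans (card_image_le _ _)).
  by apply: subset_card_le => -[x n] [].
have nT1 : ~ T 1%g.
  by move=> [[x n] [_ _ [_ nt1]] /(congr1 \val)].
have [dT cT] := closed_discrete_limit_point _ _ (subgroup_accessible T1) nT1 T_acc.
split=> //; apply: subgroup_val_dense => g.
set K := \val @` _.
have grK : is_subgroup K by apply: is_subgroup_val_image; exact: is_subgroup_gen.
have [K1 KM KV] := (is_subgroupP K).1 grK.
have SK : subgroup_gen S `<=` closure K.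
  apply: sub_closure_subgroup_gen => // x Sx.
  have [->|x1] := eqVneq x 1%g.
    by rewrite invg1; split; exact: subset_closure.
  have [_ tx _ tK] := tP x; apply: tK => //.
  (* Almost all terms survive the cut to [O x], and any of these that equals 1 is in [K] anyway. *)
  have Ot : \forall n \near \oo, O x (t x n) by apply: tx; exact: xO.
  apply: filterS Ot => n Otn.
  have [->//|tn1] := eqVneq (t x n) 1%g.
  exists (s (x, n)) => //; apply: sub_gen_smallest.
  exists (x, n) => //; split=> //; split; first by split=> //; exists n.
  exact/eqP.
(* An open set around [g] meets the dense subgroup generated by [S], which lies in [closure K], so
   it meets [K]. *)
move=> U; rewrite nbhsE => -[V [oV Vg] VU].
have [h [Vh /SK Kh]] := genS V (ex_intro _ g Vg) oV.
have [k [Kk Vk]] := Kh _ (open_nbhs_nbhs (conj oV Vh)).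
by exists k; split=> //; exact: VU.
Qed.
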